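(* Let $I$ be a two-sided ideal in a unital ring $R$ such that $I+\operatorname{cl}(R_q^{-1})=R$. Then $R/I$ is a $QB$-ring. In particular, the property of being a $QB$-ring passes to quotients: if $R$ is a unital $QB$-ring, then $R/I$ is a $QB$-ring for every two-sided ideal $I$ of $R$.
   Context: Rings are associative. For elements $x,y$ of a unital ring $R$ write $x\perp y$ if $xRy=0$ and $yRx=0$. An element $u\in R$ is quasi-invertible, written $u\in R_q^{-1}$, if there exist $a,b\in R$ with $(1-ua)\perp(1-bu)$. $\operatorname{cl}(R_q^{-1})$ is the set of $a\in R$ such that whenever $xa+b=1$ for some $x,b\in R$, there is $y\in R$ with $a+yb\in R_q^{-1}$. A unital ring $R$ is a $QB$-ring if $\operatorname{cl}(R_q^{-1})=R$. *)

(* Defs.v *)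
From HB Require Import structures.
From mathcomp Require Import all_boot all_order all_algebra.
From mathcomp Require Import generic_quotient ring_quotient.
From mathcomp Require Import boolp classical_sets.

Set Implicit Arguments.
Unset Strict Implicit.
Unset Printing Implicit Defensive.

Import GRing.Theory.

Local Open Scope classical_set_scope.
Local Open Scope ring_scope.

(* [pzRingType] (rather than [nzRingType]) because the ideal may be the whole
   ring, in which case the quotient is the zero ring. *)

Definition ring_perp (R : pzRingType) (x y : R) : Prop :=
  (forall r : R, x * r * y = 0) /\ (forall r : R, y * r * x = 0).

Definition quasi_inv (R : pzRingType) : set R :=
  [set u | exists a b : R, ring_perp (1 - u * a) (1 - b * u)].
Arguments quasi_inv : clear implicits.

Definition cl_quasi_inv (R : pzRingType) : set R :=
  [set a | forall x b : R, x * a + b = 1 ->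
             exists y : R, quasi_inv R (a + y * b)].
Arguments cl_quasi_inv : clear implicits.

Definition QB_ring (R : pzRingType) : Prop := cl_quasi_inv R = [set: R].

Record two_sided_ideal (R : pzRingType) := TwoSidedIdeal {
  ideal_set :> set R;
  ideal0 : ideal_set 0;
  idealB : forall x y : R, ideal_set x -> ideal_set y -> ideal_set (x - y);
  idealMl : forall r x : R, ideal_set x -> ideal_set (r * x);
  idealMr : forall x r : R, ideal_set x -> ideal_set (x * r)
}.

(* MathComp's [Quotient.quot] provides the additive quotient by any additive
   subgroup, but its multiplication is only available for proper ideals of
   nonzero commutative rings; it is constructed here in general. *)
Section QuotientRing.
Variables (R : pzRingType) (I : two_sided_ideal R).

Definition ideal_pred : {pred R} := [pred x | `[< ideal_set I x >]].

Lemma ideal_predE (x : R) : (x \in ideal_pred) = `[< ideal_set I x >].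
Proof. by []. Qed.

Lemma ideal_pred_zmod_closed : zmod_closed ideal_pred.
Proof.
split=> [|x y]; first by rewrite ideal_predE; apply/asboolP/ideal0.
by rewrite !ideal_predE => /asboolP Ix /asboolP Iy; apply/asboolP/idealB.
Qed.

HB.instance Definition _ := GRing.isZmodClosed.Build R ideal_pred
  ideal_pred_zmod_closed.

Definition ring_quot : Type := @Quotient.quot R ideal_pred.

HB.instance Definition _ := GRing.Zmodule.on ring_quot.
HB.instance Definition _ :=
  EqQuotient.copy ring_quot (@Quotient.quot R ideal_pred).

Definition ring_quot_pi (x : R) : ring_quot := \pi_(ring_quot)%qT x.

Lemma ring_quot_piP (x y : R) : ring_quot_pi x = ring_quot_pi y <-> ideal_set I (x - y).
Proof.
have e : `[< ideal_set I (x - y) >] = (x == y %[mod ring_quot])%qT.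
  by rewrite -ideal_predE Quotient.idealrBE.
split=> [exy|Ixy]; first by apply/asboolP; rewrite e; apply/eqP.
by apply/eqP; rewrite -e; apply/asboolP.
Qed.

Lemma ring_quot_pi_surj (c : ring_quot) : exists x, c = ring_quot_pi x.
Proof. by exists (repr c); rewrite /ring_quot_pi reprK. Qed.

Lemma ring_quot_pi_is_zmod_morphism : zmod_morphism ring_quot_pi.
Proof.
move=> x y; exact: (@pi_is_zmod_morphism R _ _ (@Quotient.quot R ideal_pred)).
Qed.

HB.instance Definition _ := GRing.isZmodMorphism.Build R ring_quot ring_quot_pi
  ring_quot_pi_is_zmod_morphism.

Definition ring_quot_one : ring_quot := ring_quot_pi 1.
Definition ring_quot_mul (c d : ring_quot) : ring_quot :=
  ring_quot_pi (repr c * repr d).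

Lemma ring_quot_piM (x y : R) :
  ring_quot_pi (x * y) = ring_quot_mul (ring_quot_pi x) (ring_quot_pi y).
Proof.
have piK z : ideal_set I (z - repr (ring_quot_pi z)).
  by apply/ring_quot_piP; rewrite /ring_quot_pi reprK.
apply/ring_quot_piP; set x' := repr _; set y' := repr _.
have -> : x * y - x' * y' = x * (y - y') - (- ((x - x') * y')).
  by rewrite opprK mulrBr mulrBl addrA addrNK.
apply: idealB; first exact/idealMl/piK.
rewrite -[- _]add0r; apply: idealB; first exact: ideal0.
exact/idealMr/piK.
Qed.

Lemma ring_quot_mulA : associative ring_quot_mul.
Proof.
move=> c d e; have [x ->] := ring_quot_pi_surj c.
have [y ->] := ring_quot_pi_surj d; have [z ->] := ring_quot_pi_surj e.
by rewrite -!ring_quot_piM mulrA.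
Qed.

Lemma ring_quot_mul1l : left_id ring_quot_one ring_quot_mul.
Proof.
by move=> c; have [x ->] := ring_quot_pi_surj c; rewrite -ring_quot_piM mul1r.
Qed.

Lemma ring_quot_mul1r : right_id ring_quot_one ring_quot_mul.
Proof.
by move=> c; have [x ->] := ring_quot_pi_surj c; rewrite -ring_quot_piM mulr1.
Qed.

Lemma ring_quot_mulDl : left_distributive ring_quot_mul +%R.
Proof.
move=> c d e; have [x ->] := ring_quot_pi_surj c.
have [y ->] := ring_quot_pi_surj d; have [z ->] := ring_quot_pi_surj e.
by rewrite -raddfD -!ring_quot_piM mulrDl raddfD.
Qed.

Lemma ring_quot_mulDr : right_distributive ring_quot_mul +%R.
Proof.
move=> c d e; have [x ->] := ring_quot_pi_surj c.
have [y ->] := ring_quot_pi_surj d; have [z ->] := ring_quot_pi_surj e.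
by rewrite -raddfD -!ring_quot_piM mulrDr raddfD.
Qed.

HB.instance Definition _ := GRing.Zmodule_isPzRing.Build ring_quot
  ring_quot_mulA ring_quot_mul1l ring_quot_mul1r
  ring_quot_mulDl ring_quot_mulDr.

Lemma ring_quot_pi_is_monoid_morphism : monoid_morphism ring_quot_pi.
Proof. by split=> // x y; rewrite ring_quot_piM. Qed.

HB.instance Definition _ := GRing.isMonoidMorphism.Build R ring_quot
  ring_quot_pi ring_quot_pi_is_monoid_morphism.

End QuotientRing.

(* Main.v *)
Require Import Defs.
From mathcomp Require Import all_boot all_order all_algebra.
From mathcomp Require Import boolp classical_sets.

Import GRing.Theory.

Local Open Scope classical_set_scope.
Local Open Scope ring_scope.

(** An equation [x a + b = 1] in [R / I] lifts to [x' c + (1 - x' c) = 1] in [R]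
    with [c] a representative of [a] chosen in the closure; the quasi-invertible
    element obtained there projects to the required one, because surjective ring
    morphisms preserve quasi-invertibility. *)

(** The relation [ring_perp] in [S] tests every middle factor [s]; surjectivity makes each one some
    [f r], so the products are images of zero products in [R]. *)
Lemma quasi_inv_rmorph (R S : pzRingType) (f : {rmorphism R -> S}) (u : R) :
  (forall s, exists r, s = f r) -> quasi_inv R u -> quasi_inv S (f u).
Proof.
move=> f_surj [a [b [ab ba]]]; exists (f a), (f b).
rewrite -!rmorphM -(rmorph1 f) -!rmorphB.
split=> s; have [r ->] := f_surj s; rewrite -!rmorphM.
  by rewrite ab rmorph0.
by rewrite ba rmorph0.
Qed.

Lemma cl_quasi_inv_rmorph (R S : pzRingType) (f : {rmorphism R -> S}) (c : R) :
  (forall s, exists r, s = f r) -> cl_quasi_inv R c -> cl_quasi_inv S (f c).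
Proof.
move=> f_surj cl_c x b xcb; have [x' x'E] := f_surj x.
(* An arbitrary lift of [b] would satisfy the equation only modulo the kernel of [f]; this one
   satisfies it exactly. *)
have [y qy] := cl_c x' (1 - x' * c) (subrKC _ _).
exists (f y); have -> : b = f (1 - x' * c).
  by rewrite rmorphB rmorph1 rmorphM -x'E -xcb addrC addKr.
by rewrite -rmorphM -rmorphD; exact: quasi_inv_rmorph.
Qed.

Lemma QB_ring_quot (R : pzRingType) (I : two_sided_ideal R) :
  [set i + c | i in I & c in cl_quasi_inv R] = [set: R] ->
  QB_ring (ring_quot I).
Proof.
move=> IclR; apply/seteqP; split=> // abar _.
have [a ->] := ring_quot_pi_surj abar.
have : [set i + c | i in I & c in cl_quasi_inv R] a by rewrite IclR.
case=> i Ii [c cl_c <-].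
(* The summand [i] dies in the quotient, so [c] represents the same class. *)
have -> : ring_quot_pi I (i + c) = ring_quot_pi I c.
  by apply/ring_quot_piP; rewrite addrK.
by apply: cl_quasi_inv_rmorph cl_c; exact: ring_quot_pi_surj.
Qed.

Theorem corollary3p8 (R : pzRingType) :
  (forall I : two_sided_ideal R,
     [set i + c | i in I & c in cl_quasi_inv R] = [set: R] ->
     QB_ring (ring_quot I))
  /\
  (QB_ring R -> forall I : two_sided_ideal R, QB_ring (ring_quot I)).
Proof.
split=> [I|QB_R I]; apply: QB_ring_quot => //.
(* The closure is already all of [R], so [a = 0 + a] works for any ideal. *)
apply/seteqP; split=> // a _; exists 0; first exact: ideal0.
by exists a; rewrite ?QB_R // add0r.
Qed.
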